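(* Let $M$ be a matroid on a finite ground set $V$ with $|V|\geqslant 2$. Assume that $M$ is not a star (i.e. no element of $V$ belongs to every basis of $M$), and that every element of $V$ belongs to some basis of $M$ (so that $a(M)$ is defined). Then $$a(M)\leqslant c(M^* ).$$
   Context: For a matroid $M$ on a finite ground set $V$, $\mathcal B(M)$ denotes the set of bases and $\mathcal C(M)$ the set of circuits (minimal dependent sets) of $M$. $M$ is called a star with a center $x\in V$ if $x\in B$ for every $B\in\mathcal B(M)$. The arboricity $a(M)$ is the minimum number of bases of $M$ whose union is $V$. The dual matroid $M^*$ is the matroid on $V$ whose set of bases is $\{V\setminus B\mid B\in\mathcal B(M)\}$. The circumference of a matroid $N$ is $c(N)=\max\{|C| \mid C\in\mathcal C(N)\}$. *)

(* Defs.v *)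
From mathcomp Require Import all_boot.

Set Implicit Arguments.
Unset Strict Implicit.
Unset Printing Implicit Defensive.

Record matroid (V : finType) := Matroid {
  bases : {set {set V}};
  bases_neq0 : bases != set0;
  bases_exchange : forall A B : {set V}, A \in bases -> B \in bases ->
    forall x, x \in A :\: B ->
    exists2 y, y \in B :\: A & y |: (A :\ x) \in bases
}.

Section Matroid.

Variable V : finType.
Implicit Types (M : matroid V) (A B C : {set V}) (x y : V).

Definition indep M A : bool := [exists B in bases M, A \subset B].

Definition circuits M : {set {set V}} :=
  [set C | minset (fun A => ~~ indep M A) C].

Definition star_center M x : bool := [forall B in bases M, x \in B].

Definition star M : bool := [exists x, star_center M x].

Definition covering_bases M (F : {set {set V}}) : bool :=
  (F \subset bases M) && (cover F == [set: V]).

(* Meaningful when the bases cover V: the default [bases M] is then itself a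
   covering family, so [arg min] attains the minimum. *)
Definition arboricity M : nat :=
  #|[arg min_(F < bases M | covering_bases M F) #|F| ]|.

(* Equal to 0 when [M] has no circuit. *)
Definition circumference M : nat := \max_(C in circuits M) #|C|.

Lemma bases_antichain M A B :
  A \in bases M -> B \in bases M -> A \subset B -> A = B.
Proof.
move=> hA hB sAB; apply/eqP; rewrite eqEsubset sAB /=.
apply/subsetP=> x xB; apply: contraT => xA.
have [|y] := bases_exchange hB hA (x := x); first by rewrite inE xA.
by rewrite inE => /andP[yB /(subsetP sAB)]; rewrite (negPf yB).
Qed.

Lemma bases_dual_exchange M A B x :
    A \in bases M -> B \in bases M -> x \in B :\: A ->
  exists2 y, y \in A :\: B & x |: (A :\ y) \in bases M.
Proof.
move=> hA; have [n] := ubnP #|B :\: A|.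
elim: n B => // n IHn B; rewrite ltnS => leBn hB xBA.
have [/existsP[z /andP[zx zBA]]|noz] :=
  boolP [exists z, (z != x) && (z \in B :\: A)].
  have [y yAB hB'] := bases_exchange hB hA zBA.
  have [||y' y'A] := IHn _ _ hB'; last 1 first.
  - exists y' => //; move: y'A zBA; rewrite !inE.
    case: (y' =P z) => [->|_] /=; last by case/andP=> /norP[_ ->].
    by case/andP=> _ zA; rewrite zA.
  - apply: leq_trans leBn; apply: proper_card; apply/properP; split.
      apply/subsetP=> u; move: yAB; rewrite !inE => /andP[_ yA].
      by case/andP=> uA; case: eqP uA => [->|_ ->] /=;
        [rewrite yA | case/andP].
    exists z => //; move: yAB zBA; rewrite !inE eqxx /= => /andP[yB _].
    by case/andP=> -> zB; rewrite orbF; apply: contraNneq yB => <-.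
  by move: xBA; rewrite !inE (eq_sym x z) zx => /andP[-> ->]; rewrite orbT.
have [y yAB hB'] := bases_exchange hB hA xBA; exists y => //.
have defA : y |: (B :\ x) = A.
  apply: bases_antichain hB' hA _; apply/subsetP=> u; rewrite !inE.
  case: eqP => [-> _|_ /= /andP[ux uB]]; first by case/setDP: yAB.
  apply: contraNT noz => uA; apply/existsP; exists u.
  by rewrite ux inE uA.
have [yA yB] := setDP yAB; have [xB xA] := setDP xBA.
suff -> : x |: (A :\ y) = B by [].
by rewrite -defA setU1K ?setD1K // !inE negb_and yB orbT.
Qed.

Definition dual_bases M : {set {set V}} := [set ~: B | B in bases M].

Fact dual_bases_neq0 M : dual_bases M != set0.
Proof.
have /set0Pn[B hB] := bases_neq0 M.
by apply/set0Pn; exists (~: B); apply: imset_f.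
Qed.

Fact dual_bases_exchange M A B :
    A \in dual_bases M -> B \in dual_bases M ->
  forall x, x \in A :\: B ->
  exists2 y, y \in B :\: A & y |: (A :\ x) \in dual_bases M.
Proof.
case/imsetP=> A' hA ->{A} /imsetP[B' hB ->{B}] x.
rewrite setDE setCK setIC -setDE => xBA.
have [y yAB hC] := bases_dual_exchange hA hB xBA.
exists y; first by rewrite setDE setCK setIC -setDE.
apply/imsetP; exists (x |: (A' :\ y)) => //.
have [yA _] := setDP yAB; have [_ xA] := setDP xBA.
apply/setP=> u; rewrite !inE negb_or negb_and negbK.
case: (u =P y) => [->|_] //=.
by rewrite andbT; apply/esym; apply: contraNneq xA => <-.
Qed.

Definition dual M : matroid V :=
  Matroid (dual_bases_neq0 M) (@dual_bases_exchange M).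

End Matroid.

(* Main.v *)
(** Fix a basis [B] and an order on it, and send each [x] to the first [b] of
[B] for which [B - b + x] is a basis.  The fibre over [b] lies in the
fundamental cocircuit of [b], so it has at most [c] elements, where [c] is the
circumference of the dual; and every transversal of the fibres is a basis, since
its members can be exchanged into [B] one after the other.  The fibres partition
[V], so [c] transversals cover it. *)
Require Import Defs.
From mathcomp Require Import all_boot.

Set Implicit Arguments.
Unset Strict Implicit.
Unset Printing Implicit Defensive.

Section Bases.

Variables (V : finType) (M : matroid V).
Implicit Types (A B C I : {set V}) (b x y : V).

Lemma card_bases A B : A \in bases M -> B \in bases M -> #|A| = #|B|.
Proof.
have [n] := ubnP #|A :\: B|; elim: n A => // n IHn A.
rewrite ltnS => leAn hA hB.
have [AB0|[x xAB]] := set_0Vmem (A :\: B).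
  by rewrite (bases_antichain hA hB) // -setD_eq0 AB0.
have [y yBA hA'] := bases_exchange hA hB xAB.
have [[xA xB] [yB yA]] := (setDP xAB, setDP yBA).
rewrite -(IHn _ _ hA' hB).
  by rewrite cardsU1 !inE (negPf yA) andbF [LHS](cardsD1 x) xA.
apply: leq_trans leAn; apply: proper_card; apply/properP; split; last first.
  by exists x => //; rewrite !inE eqxx /= orbF xB; apply: contraNneq yA => <-.
apply/subsetP=> u; rewrite !inE => /andP[uB].
by case: eqP uB => [->|_ ->] /=; [rewrite yB | case/andP].
Qed.

Lemma bases_sub_eq A C :
  A \in bases M -> A \subset C -> #|C| <= #|A| -> C \in bases M.
Proof.
by move=> hA sAC leCA; have /eqP <- : A == C by rewrite eqEcard sAC.
Qed.

(** An element of [A] outside [I :|: C] is exchanged for one of [C]; this keeps [I] inside the basis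
    and shrinks [A :\: (I :|: C)]. *)
Lemma bases_extend I A C :
    A \in bases M -> I \subset A -> C \in bases M ->
  exists B, [/\ B \in bases M, I \subset B & B \subset I :|: C].
Proof.
move=> + + hC; have [n] := ubnP #|A :\: (I :|: C)|; elim: n A => // n IHn A.
rewrite ltnS => leAn hA sIA.
have [/eqP|[x]] := set_0Vmem (A :\: (I :|: C)).
  by rewrite setD_eq0; exists A.
rewrite !inE negb_or => /andP[/andP[xI xC] xA].
have [|y yCA hA'] := bases_exchange hA hC (x := x); first by rewrite inE xC.
have [yC yA] := setDP yCA.
apply: IHn hA' _; last first.
  apply/subsetP=> u uI; rewrite !inE (subsetP sIA) // andbT.
  by apply/orP; right; apply: contraNneq xI => <-.
apply: leq_trans leAn; apply: proper_card; apply/properP; split; last first.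
  exists x; first by rewrite !inE negb_or xI xC.
  rewrite !inE eqxx /= orbF negb_and; apply/orP; right.
  by apply: contraNneq yA => <-.
apply/subsetP=> u; rewrite !inE => /andP[uIC].
by case: eqP uIC => [->|_ ->] /=; [rewrite yC orbT | case/andP].
Qed.

Definition exchangeable B b x := x |: (B :\ b) \in bases M.

Lemma exchangeable_mem B b x :
  B \in bases M -> b \in B -> x \in B -> exchangeable B b x -> x = b.
Proof.
move=> hB bB xB h; apply: contraTeq isT => nxb.
have := card_bases h hB; rewrite cardsU1 !inE nxb xB add0n (cardsD1 b B) bB.
by move/eqP; rewrite eqn_leq ltnn andbF.
Qed.

(** Avoiding [b] confines [A] to [x |: (B :\ b)], which has at most [#|A|] elements. *)
Lemma exchangeable_sub A B b x :
    A \in bases M -> B \in bases M -> A \subset x |: B -> b \in B :\: A ->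
  exchangeable B b x.
Proof.
move=> hA hB sA /setDP[bB bA]; apply: (bases_sub_eq hA).
  apply/subsetP=> u uA; have := subsetP sA _ uA; rewrite !inE.
  by case: eqP => //= _ ->; rewrite andbT; apply: contraNneq bA => <-.
rewrite cardsU1 (card_bases hA hB) (cardsD1 b B) bB.
by rewrite leq_add2r leq_b1.
Qed.

Lemma exchangeable_id B b : B \in bases M -> b \in B -> exchangeable B b b.
Proof. by move=> hB bB; rewrite /exchangeable setD1K. Qed.

Lemma exists_exchangeable A B x :
  A \in bases M -> x \in A -> B \in bases M ->
  exists2 b, b \in B & exchangeable B b x.
Proof.
move=> hA xA hB; have [xB|xB] := boolP (x \in B).
  by exists x => //; apply: exchangeable_id.
have [|C [hC]] := bases_extend (I := [set x]) hA _ hB; first by rewrite sub1set.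
rewrite sub1set => xC sC.
have [/subsetP sBC|/subsetPn[b bB bC]] := boolP (B \subset C).
  by case/negP: xB; rewrite (bases_antichain hB hC) //; apply/subsetP.
by exists b => //; apply: exchangeable_sub hC hB sC _; rewrite inE bC.
Qed.

(** Dependence in the dual means meeting every basis of [M]. A basis [A] is met because completing
    [B :\ b] from [A] adds an exchangeable element; and once some [x] is removed, what remains
    misses the basis [x |: (B :\ b)]. *)
Lemma fundamental_cocircuit B b :
  B \in bases M -> b \in B ->
  [set x | exchangeable B b x] \in circuits (dual M).
Proof.
move=> hB bB; rewrite inE; apply/minsetP; split.
  apply/existsPn=> A'; rewrite negb_and -implybE; apply/implyP.
  case/imsetP=> A hA ->; apply/subsetPn.
  have [C [hC sC sCA]] := bases_extend hB (subsetDl B [set b]) hA.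
  have ltBC : #|B :\ b| < #|C| by rewrite (card_bases hC hB) (cardsD1 b B) bB.
  have /subsetPn[x xC xB] : ~~ (C \subset B :\ b).
    by apply: contraL ltBC => /subset_leq_card; rewrite -leqNgt.
  exists x; last first.
    by have := subsetP sCA _ xC; rewrite in_setU (negPf xB) /= inE negbK.
  rewrite inE; have -> // : exchangeable B b x.
  rewrite /exchangeable; have /eqP -> // : x |: (B :\ b) == C.
  rewrite eqEcard subUset sub1set xC sC cardsU1 xB.
  by rewrite (card_bases hC hB) (cardsD1 b B) bB leqnn.
move=> E nE sE; apply/eqP; rewrite eqEsubset sE /=.
apply: contraNT nE => /subsetPn[x]; rewrite inE => hx xE.
apply/existsP; exists (~: (x |: (B :\ b))); rewrite imset_f //=.
apply/subsetP=> u uE; rewrite !inE negb_or (contraNneq _ xE) => [|<- //].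
have := subsetP sE _ uE; rewrite inE negb_and negbK => hu.
case: (boolP (u \in B)) => uB; rewrite ?orbT //.
by rewrite (exchangeable_mem hB bB uB hu) eqxx.
Qed.

Lemma card_exchangeable B b :
  B \in bases M -> b \in B ->
  #|[set x | exchangeable B b x]| <= circumference (dual M).
Proof.
move=> hB bB.
by rewrite /circumference (bigmax_sup _ (fundamental_cocircuit hB bB)).
Qed.

Definition first_exchangeable B x b :=
  [/\ b \in B, exchangeable B b x
    & forall b', b' \in B -> exchangeable B b' x ->
        enum_rank b <= enum_rank b'].

Lemma exists_first_exchangeable A B x :
  A \in bases M -> x \in A -> B \in bases M ->
  exists b, first_exchangeable B x b.
Proof.
move=> hA xA hB; have [b0 b0B hb0] := exists_exchangeable hA xA hB.
pose P b := (b \in B) && exchangeable B b x.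
have Pb0 : P b0 by rewrite /P b0B.
case: (arg_minnP (fun b => enum_rank b : nat) Pb0) => b /andP[bB hb] min_b.
by exists b; split=> // b' b'B hb'; apply: min_b; rewrite /P b'B.
Qed.

Lemma transversal_basis B (t : V -> V) :
    B \in bases M -> (forall b, b \in B -> first_exchangeable B (t b) b) ->
  t @: B \in bases M.
Proof.
move=> hB ht.
(* The members of [B] are replaced in increasing rank, those of rank below [n] being already
   swapped: [C 0] is [B] and [C #|V|] is the transversal. *)
pose C n := [set if enum_rank b < n then t b else b | b in B].
suff hC n : C n \in bases M.
  have -> // : t @: B = C #|V|.
  by apply: eq_imset => b; rewrite ltn_ord.
elim: n => [|n IHn].
  by rewrite /C (eq_imset (g := id)) ?imset_id // => b; rewrite ltn0.
(* Ranks are taken in [V], so [n] may be the rank of no element of [B]; then nothing changes. *)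
have [/existsP[b0 /andP[b0B /eqP rb0]]|nob] :=
  boolP [exists b, (b \in B) && (enum_rank b == n :> nat)]; last first.
  suff -> : C n.+1 = C n by [].
  apply: eq_in_imset => b bB; rewrite ltnS leq_eqVlt.
  by move/existsPn/(_ b): nob; rewrite bB /= => /negPf ->.
have other b : b != b0 -> (enum_rank b < n.+1) = (enum_rank b < n).
  move=> nb; rewrite ltnS leq_eqVlt -rb0.
  by rewrite (inj_eq val_inj) (inj_eq enum_rank_inj) (negPf nb).
have [_ hx minx] := ht _ b0B; set x := t b0 in hx minx.
have xC : x \in C n.+1 by apply/imsetP; exists b0 => //; rewrite rb0 ltnSn.
have CnS u : u \in C n -> u != b0 -> u \in C n.+1.
  case/imsetP=> b bB -> nu; apply/imsetP; exists b => //; rewrite other //.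
  by apply: contraNneq nu => ->; rewrite rb0 ltnn.
(* This bound makes any basis inside [C n.+1] equal to it, so injectivity of [t] on [B] takes no
   separate argument. *)
have leC : #|C n.+1| <= #|B| by apply: leq_imset_card.
have [xB|xB] := boolP (x \in B).
  apply: (bases_sub_eq IHn); last by rewrite (card_bases IHn hB).
  apply/subsetP=> u uC; have [->|] := eqVneq u b0; last exact: CnS.
  by rewrite -(exchangeable_mem hB b0B xB hx).
(* The elements of [B] after [b0] are unswapped in both [C n] and [C n.+1], so a basis completing
   [I] from [C n] lies in [C n.+1] as soon as it avoids [b0]. *)
pose I := x |: [set b in B | n < enum_rank b].
have sI : I \subset x |: (B :\ b0).
  apply/setUS/subsetP=> b; rewrite !inE => /andP[bB rb].
  by rewrite bB andbT; apply: contraTneq rb => ->; rewrite rb0 ltnn.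
have [A [hA sIA sA]] := bases_extend hx sI IHn.
apply: (bases_sub_eq hA); last by rewrite (card_bases hA hB).
(* If [A] contained [b0], then [x] and the elements of [B] from [b0] on would be
   independent, and [x] could be exchanged for an element of [B] before [b0]. *)
have b0A : b0 \notin A.
  apply/negP=> b0A; pose J := x |: [set b in B | n <= enum_rank b].
  have sJA : J \subset A.
    apply/subsetP=> b /setU1P[->|]; first by rewrite (subsetP sIA) ?setU11.
    rewrite inE leq_eqVlt => /andP[bB /orP[/eqP rb|rb]].
      by rewrite rb in rb0; have /val_inj/enum_rank_inj <- := rb0.
    by rewrite (subsetP sIA) // !inE bB rb orbT.
  have [D [hD sD sDB]] := bases_extend hA sJA hB.
  have sDxB : D \subset x |: B.
    apply: subset_trans sDB _; rewrite /J -setUA setUS // subUset subxx andbT.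
    by apply/subsetP=> b; rewrite inE => /andP[].
  have xD : x \in D by apply: (subsetP sD); rewrite setU11.
  have /subsetPn[b bB bD] : ~~ (B \subset D).
    by apply: contra xB => sBD; rewrite (bases_antichain hB hD sBD).
  (* Since [b0] is first for [x], the rank of [b] is at least [n]; so [b] lies in [J], hence in
     [D]. *)
  have /(minx _ bB) : exchangeable B b x.
    by apply: exchangeable_sub hD hB sDxB _; rewrite inE bD.
  rewrite rb0 => rb; case/negP: bD; apply: (subsetP sD).
  by rewrite !inE bB rb orbT.
apply/subsetP=> u uA; have := subsetP sA _ uA; rewrite in_setU => /orP[uI|uC].
  case/setU1P: uI => [->//|]; rewrite inE => /andP[uB ru].
  by apply/imsetP; exists u => //; rewrite ltnS leqNgt ru.
by apply: CnS => //; apply: contraNneq b0A => <-.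
Qed.

End Bases.

Theorem theorem3p3 (V : finType) (M : matroid V)
    (cardV : 2 <= #|V|)
    (not_star : ~~ star M)
    (bases_cover : forall x : V, exists2 B : {set V}, B \in bases M & x \in B) :
  arboricity M <= circumference (dual M).
Proof.
have /set0Pn[B hB] := bases_neq0 M.
have /fin_all_exists[f hf] x : exists b, first_exchangeable M B x b.
  by have [A hA xA] := bases_cover x; apply: exists_first_exchangeable hA xA hB.
have fB b : b \in B -> f b = b.
  move=> bB; have [fbB hfb _] := hf b.
  by rewrite -(exchangeable_mem hB fbB bB hfb).
pose D b := enum [set x | f x == b].
(* The default [b] lies in its own fibre because [f] fixes [B]; so [t j] picks from every fibre,
   even one with at most [j] elements. *)
pose t j b := nth b (D b) j.
have ft j b : b \in B -> f (t j b) = b.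
  move=> bB; rewrite /t; have [lt_j|ge_j] := ltnP j (size (D b)).
    by have := mem_nth b lt_j; rewrite mem_enum inE => /eqP.
  by rewrite nth_default // fB.
have sizeD b : b \in B -> size (D b) <= circumference (dual M).
  move=> bB; apply: leq_trans (card_exchangeable hB bB).
  rewrite -cardE; apply/subset_leq_card/subsetP=> x; rewrite !inE => /eqP <-.
  by have [] := hf x.
pose F := [set t j @: B | j : 'I_(circumference (dual M))].
have coverF : covering_bases M F.
  apply/andP; split.
    apply/subsetP=> _ /imsetP[j _ ->]; apply: transversal_basis hB _ => b bB.
    by rewrite -{2}(ft j b bB).
  apply/eqP/setP=> x; rewrite inE; apply/bigcupP.
  have [fxB _ _] := hf x.
  have xD : x \in D (f x) by rewrite mem_enum inE.
  (* The position of [x] in its fibre tells which transversal contains it. *)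
  have lt_j : index x (D (f x)) < circumference (dual M).
    by rewrite (leq_trans _ (sizeD _ fxB)) // index_mem.
  exists (t (Ordinal lt_j) @: B); first exact: imset_f.
  by apply/imsetP; exists (f x); rewrite // /t /= nth_index.
(* The default of the [arg min] must itself be a covering family for [arg_minnP] to apply. *)
have cover_all : covering_bases M (bases M).
  rewrite /covering_bases subxx; apply/eqP/setP=> x; rewrite inE.
  by apply/bigcupP; have [A hA xA] := bases_cover x; exists A.
rewrite /arboricity; case: arg_minnP => // G _ /(_ _ coverF) leGF.
by rewrite (leq_trans leGF) // (leq_trans (leq_imset_card _ _)) // card_ord.
Qed.
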